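(* Assume $g$ is separable, $g(x)=\sum_{j=1}^dg_j(x^{(j)})$, that $g$ is $\mu_g$-strongly convex with $\mu_g>0$, and that each $h_i^*$ is $\mu_h$-strongly convex with $\mu_h>0$. Let $\pi^{(j)}=|I(j)|/n$. Run the sparse PURE-CD algorithm (described in the context) with constant parameters, for all $k\ge0$, $$\theta_k^{(j)}=\theta^{(j)}=\frac{\pi^{(j)}n}{1+\mu_g\tau^{(j)}},\qquad \tau_k^{(j)}=\tau^{(j)}=\frac{\sqrt{\mu_h}}{\sqrt{\mu_g}\,\max_i\|A_i\|\,\pi^{(j)}n},\qquad \sigma_k^{(i)}=\sigma^{(i)}=\frac{\sqrt{\mu_g}}{\sqrt{\mu_h}\,\|A_i\|}.$$ Then $\mathbb{E}\left[\|x_K-x_\star\|^2+\|y_K-y_\star\|^2\right]\le\varepsilon$ with expected complexity $$\tilde O\left(\left(\mathrm{nnz}(A)+\mathrm{nnz}(A)\frac{\max_i\|A_i\|}{\sqrt{\mu_h\mu_g}}\right)\log\varepsilon^{-1}\right),$$ where $(x_\star,y_\star)$ is the (unique) saddle point.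
   Context: Problem: $\min_{x\in\mathbb{R}^d}\max_{y\in\mathbb{R}^n} L(x,y)$ with $L(x,y)=\langle Ax,y\rangle-h^*(y)+g(x)$, where $A\in\mathbb{R}^{n\times d}$ has rows $A_1,\dots,A_n$, $g:\mathbb{R}^d\to(-\infty,+\infty]$ and $h^*:\mathbb{R}^n\to(-\infty,+\infty]$ are proper convex lower semicontinuous, and $h^*(y)=\sum_{i=1}^n h_i^*(y^{(i)})$ is separable (superscript $(i)$ denotes the $i$-th coordinate). It is assumed that a saddle point $(x_\star,y_\star)$ exists: $L(x,y_\star)\ge L(x_\star,y_\star)\ge L(x_\star,y)$ for all $x,y$. A convex $f$ is $\mu$-strongly convex if $f(u)\ge f(v)+\langle q,u-v\rangle+\frac\mu2\|u-v\|^2$ for all $u,v$ and $q\in\partial f(v)$. Notation: $\|\cdot\|$ is the Euclidean norm; $\mathrm{nnz}(A)$ is the number of nonzero entries of $A$; $J(i)=\{j:A_{i,j}\ne0\}$, $I(j)=\{i:A_{i,j}\neq0\}$. $\mathrm{prox}_{\tau,f}(x)=\arg\min_u\{f(u)+\frac1{2\tau}|u-x|^2\}$ for scalar $\tau>0$. Sparse PURE-CD algorithm: start from $x_0\in\mathrm{dom}\,g$, $y_0\in\mathrm{dom}\,h^*$. Given step sizes $\tau_k^{(j)},\sigma_k^{(i)},\theta_k^{(j)}$, for $k=0,1,\dots$: 1. pick $i_k\in\{1,\dots,n\}$ uniformly at random, independently of the past; 2. $\bar x_{k+1}^{(j)}=\mathrm{prox}_{\tau_k^{(j)},g_j}\big(x_k^{(j)}-\tau_k^{(j)}(A^\top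 y_k)^{(j)}\big)$ for $j\in J(i_k)$; 3. $y_{k+1}^{(i_k)}=\mathrm{prox}_{\sigma_k^{(i_k)},h_{i_k}^*}\big(y_k^{(i_k)}+\sigma_k^{(i_k)}A_{i_k}\bar x_{k+1}\big)$ (only the coordinates of $\bar x_{k+1}$ in $J(i_k)$ matter), and $y_{k+1}^{(i)}=y_k^{(i)}$ for $i\ne i_k$; 4. $x_{k+1}^{(j)}=\bar x_{k+1}^{(j)}-\tau_k^{(j)}\theta_k^{(j)}A_{i_k,j}(y_{k+1}^{(i_k)}-y_k^{(i_k)})$ for $j\in J(i_k)$, and $x_{k+1}^{(j)}=x_k^{(j)}$ for $j\notin J(i_k)$. Complexity convention: the expected complexity is the number of iterations $K$ multiplied by the expected cost per iteration $\frac1n\sum_i\mathrm{nnz}(A_i)=\frac1n\mathrm{nnz}(A)$ (iteration $k$ costs $O(|J(i_k)|)$). The notation $\tilde O$ suppresses the constants (weighted initial distance to the solution) inside the logarithm. *)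

(* Defs.v *)
From mathcomp Require Export all_boot all_order all_algebra.
From mathcomp Require Export all_classical all_reals all_analysis.
Export Order.TTheory GRing.Theory Num.Theory.
Export numFieldNormedType.Exports.

Set Implicit Arguments.
Unset Strict Implicit.
Unset Printing Implicit Defensive.


Local Open Scope ring_scope.

(* The norm of 'cV[R]_m in the library is the sup norm, hence enorm below. *)
Definition dotp (R : realType) (m : nat) (u v : 'cV[R]_m) : R :=
  \sum_(i < m) u i 0 * v i 0.

Definition enorm (R : realType) (m : nat) (u : 'cV[R]_m) : R :=
  Num.sqrt (dotp u u).

Section Sparsity.
Context (R : realType) (n d : nat).
Implicit Types A : 'M[R]_(n, d).

Definition row_supp A (i : 'I_n) : {set 'I_d} := [set j | A i j != 0].

Definition col_supp A (j : 'I_d) : {set 'I_n} := [set i | A i j != 0].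

Definition nnz A : nat := #|[set p : 'I_n * 'I_d | A p.1 p.2 != 0]|.

Definition row_norm A (i : 'I_n) : R := enorm (row i A)^T.

(* Row norms are nonnegative, so the default value 0 is harmless. *)
Definition max_row_norm A : R := \big[Num.max/0]_(i < n) row_norm A i.

(* K iterations, each of expected cost n^-1 * \sum_i nnz(A_i). *)
Definition expected_complexity A (K : nat) : R :=
  K%:R * (n%:R^-1 * \sum_(i < n) #|row_supp A i|%:R).

End Sparsity.

Local Open Scope classical_set_scope.

Section Convexity.
Context (R : realType).

Definition proper (V : Type) (f : V -> \bar R) : Prop :=
  (forall x, f x != -oo%E) /\ (exists x, f x != +oo%E).

(* The weight t is in ]0, 1[ because 0 * +oo = 0 in \bar R. *)
Definition econvex (V : lmodType R) (f : V -> \bar R) : Prop :=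
  forall (x y : V) (t : R), 0 < t < 1 ->
    (f (t *: x + (1 - t) *: y)%R <= t%:E * f x + (1 - t)%:E * f y)%E.

(* ip is the inner product: dotp on 'cV[R]_m, multiplication on R.
   For a proper f, the set is empty at points where f is +oo. *)
Definition subdifferential (V : zmodType) (ip : V -> V -> R)
    (f : V -> \bar R) (v : V) : set V :=
  [set q | forall u, (f v + (ip q (u - v))%:E <= f u)%E].

Definition strongly_convex (V : zmodType) (ip : V -> V -> R) (mu : R)
    (f : V -> \bar R) : Prop :=
  forall u v q, subdifferential ip f v q ->
    (f v + (ip q (u - v) + mu / 2 * ip (u - v) (u - v))%:E <= f u)%E.

Definition prox (tau : R) (f : R -> \bar R) (x : R) : R :=
  xget 0 [set p | forall u, (f p + ((2 * tau)^-1 * (p - x) ^+ 2)%:E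
                          <= f u + ((2 * tau)^-1 * (u - x) ^+ 2)%:E)%E].

End Convexity.

Section SaddlePoint.
Context (R : realType) (n d : nat) (A : 'M[R]_(n, d)).
Context (g : 'cV[R]_d -> \bar R) (hs : 'cV[R]_n -> \bar R).

(* +oo + -oo = -oo in \bar R. For proper g and hs, this convention still makes
   g x and hs y finite at every saddle point (x, y), so the inequalities below
   never depend on it. *)
Definition lagrangian (x : 'cV[R]_d) (y : 'cV[R]_n) : \bar R :=
  ((dotp (A *m x) y)%:E - hs y + g x)%E.

Definition saddle_point (xs : 'cV[R]_d) (ys : 'cV[R]_n) : Prop :=
  forall x y, (lagrangian xs ys <= lagrangian x ys)%E /\
              (lagrangian xs y <= lagrangian xs ys)%E.

End SaddlePoint.

Section PureCD.
Context (R : realType) (n d : nat) (A : 'M[R]_(n, d)).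
Context (g_ : 'I_d -> R -> \bar R) (hs_ : 'I_n -> R -> \bar R).

(* Outside the support of row i, xbar is irrelevant; it is set to x there. *)
Definition pure_cd_step (tau : 'I_d -> R) (sigma : 'I_n -> R)
    (theta : 'I_d -> R) (i : 'I_n) (z : 'cV[R]_d * 'cV[R]_n) :
    'cV[R]_d * 'cV[R]_n :=
  let: (x, y) := z in
  let xbar : 'cV[R]_d := \col_j
    if j \in row_supp A i
    then prox (tau j) (g_ j) (x j 0 - tau j * (A^T *m y) j 0)
    else x j 0 in
  let ynext : 'cV[R]_n := \col_l
    if l == i
    then prox (sigma i) (hs_ i) (y i 0 + sigma i * (A *m xbar) i 0)
    else y l 0 in
  let xnext : 'cV[R]_d := \col_j
    if j \in row_supp A i
    then xbar j 0 - tau j * theta j * A i j * (ynext i 0 - y i 0)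
    else x j 0 in
  (xnext, ynext).

Fixpoint pure_cd (tau : nat -> 'I_d -> R) (sigma : nat -> 'I_n -> R)
    (theta : nat -> 'I_d -> R) (x0 : 'cV[R]_d) (y0 : 'cV[R]_n)
    (idx : nat -> 'I_n) (k : nat) : 'cV[R]_d * 'cV[R]_n :=
  if k is k'.+1 then
    pure_cd_step (tau k') (sigma k') (theta k') (idx k')
      (pure_cd tau sigma theta x0 y0 idx k')
  else (x0, y0).

End PureCD.

Definition iid_uniform (R : realType) (dT : measure_display)
    (T : measurableType dT) (P : probability T R) (n : nat)
    (idx : nat -> T -> 'I_n) : Prop :=
  [/\ forall k i, measurable [set w | idx k w = i],
      forall k i, P [set w | idx k w = i] = (n%:R^-1)%:E
    & forall (s : seq nat) (e : nat -> 'I_n), uniq s ->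
        P [set w | forall k, k \in s -> idx k w = e k] =
        (\prod_(k <- s) P [set w | idx k w = e k])%E].

Section StepSizes.
Context (R : realType) (n d : nat) (A : 'M[R]_(n, d)) (mug muh : R).

Definition col_prob (j : 'I_d) : R := #|col_supp A j|%:R / n%:R.

Definition pcd_tau (j : 'I_d) : R :=
  Num.sqrt muh / (Num.sqrt mug * max_row_norm A * col_prob j * n%:R).

Definition pcd_sigma (i : 'I_n) : R :=
  Num.sqrt mug / (Num.sqrt muh * row_norm A i).

Definition pcd_theta (j : 'I_d) : R :=
  col_prob j * n%:R / (1 + mug * pcd_tau j).

(* Weights of the Lyapunov function of the method: in expectation, each
   iteration reduces
     \sum_j primal_weight j * (x^(j) - xs^(j))^2
     + \sum_i dual_weight i * (y^(i) - ys^(i))^2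
   at least by the factor 1 - (n + n * max_i ||A_i|| / sqrt (muh * mug))^-1. *)
Definition primal_weight (j : 'I_d) : R :=
  (1 + mug * pcd_tau j) / (pcd_tau j * col_prob j).

Definition dual_weight (i : 'I_n) : R :=
  n%:R * (1 + muh * pcd_sigma i) / pcd_sigma i.

(* Weighted squared distance, normalized by the smallest weight so that it
   bounds the unweighted one. *)
Definition weighted_dist2 (x xs : 'cV[R]_d) (y ys : 'cV[R]_n) : R :=
  Num.max (\big[Num.max/0]_(j < d) (primal_weight j)^-1)
          (\big[Num.max/0]_(i < n) (dual_weight i)^-1) *
  (\sum_(j < d) primal_weight j * (x j 0 - xs j 0) ^+ 2 +
   \sum_(i < n) dual_weight i * (y i 0 - ys i 0) ^+ 2).

End StepSizes.

(* Main.v *)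
(* Let V(x, y) be the sum of primal_weight j * (x j - xs j)^2 and
   dual_weight i * (y i - ys i)^2. The three-point inequality of prox, improved
   by strong convexity and tested against the subgradients - A^T ys and A xs of
   g and hs at the saddle point, bounds a full prox step taking the errors
   (u, v) to (ub, vb). In the average of V over the sampled row, theta makes the
   extrapolation term - 2 <ub, A^T (vb - v)> cancel the bilinear terms
   - 2 <A^T v, ub> + 2 <A ub, vb>, and the choice of tau and sigma lets the term
   (vb - v)^2 / sigma absorb the quadratic error of the extrapolation. What
   remains is the contraction of V by 1 - 1 / kappa with
   kappa = n + n * max_i ||A_i|| / sqrt (muh * mug), from every point.
   Minimizers defining prox exist because the subgradients at the saddle point
   provide affine minorants of the components of g and hs. *)
Require Import Defs.
From mathcomp Require Import measurable_realfun ring lra.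

Set Implicit Arguments.
Unset Strict Implicit.
Unset Printing Implicit Defensive.

Local Open Scope classical_set_scope.
Local Open Scope ring_scope.

(** * One-step descent of the Lyapunov function *)

(* u and v are the current errors, ub and vb those after a full prox step;
   a and b are the inverse step sizes, s the products tau * theta. *)
Lemma lyapunov_descent (R : realFieldType) (n d : nat) (A : 'I_n -> 'I_d -> R)
    (mu nu kappa : R) (a s p u ub : 'I_d -> R) (b q v vb : 'I_n -> R) :
  0 < kappa ->
  (forall j, (a j + mu) * ub j ^+ 2 <=
     a j * u j ^+ 2 - 2 * (\sum_(i < n) A i j * v i) * ub j) ->
  (forall i, (b i + nu) * vb i ^+ 2 <=
     b i * v i ^+ 2 - b i * (vb i - v i) ^+ 2 +
     2 * (\sum_(j < d) A i j * ub j) * vb i) ->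
  (forall j, p j * (\sum_(i < n) (A i j != 0)%:R) = n%:R * (a j + mu)) ->
  (forall j, p j * s j = n%:R) ->
  (forall j, p j <= kappa * mu) ->
  (forall i, q i = n%:R * (b i + nu)) ->
  (forall i, q i <= kappa * nu) ->
  (forall i, \sum_(j < d) s j * A i j ^+ 2 <= b i) ->
  \sum_(i < n)
    (\sum_(j < d) p j *
       (if A i j != 0 then ub j - s j * A i j * (vb i - v i) else u j) ^+ 2 +
     \sum_(l < n) q l * (if l == i then vb i else v l) ^+ 2) <=
  n%:R * ((1 - kappa^-1) *
    (\sum_(j < d) p j * u j ^+ 2 + \sum_(i < n) q i * v i ^+ 2)).
Proof.
move=> k0 Hx Hy Hpc Hps Hp Hq Hqk Hs.
have primal : \sum_(i < n) \sum_(j < d) p j *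
      (if A i j != 0 then ub j - s j * A i j * (vb i - v i) else u j) ^+ 2 =
    n%:R * (\sum_(j < d) (a j + mu) * (ub j ^+ 2 - u j ^+ 2))
    + n%:R * (\sum_(j < d) p j * u j ^+ 2)
    - n%:R * 2 * (\sum_(i < n) \sum_(j < d) A i j * ub j * (vb i - v i))
    + n%:R * (\sum_(i < n) (\sum_(j < d) s j * A i j ^+ 2) * (vb i - v i) ^+ 2).
  (* Since [p j * s j = n], the last two terms have coefficient [n] in every column; their factor
     [A i j] makes them vanish off the support, so only the first term keeps an indicator. *)
  have E i j : p j *
      (if A i j != 0 then ub j - s j * A i j * (vb i - v i) else u j) ^+ 2 =
      p j * (A i j != 0)%:R * (ub j ^+ 2 - u j ^+ 2) + p j * u j ^+ 2
      - n%:R * 2 * (A i j * ub j * (vb i - v i))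
      + n%:R * (s j * A i j ^+ 2 * (vb i - v i) ^+ 2).
    rewrite -(Hps j); case: eqVneq => [->|_] /=; ring.
  under eq_bigr do under eq_bigr do rewrite E.
  under eq_bigr do rewrite !big_split /= sumrN -!mulr_sumr -mulr_suml.
  rewrite !big_split /= sumrN -!mulr_sumr exchange_big /=.
  congr (_ + _ - _ + _).
  - rewrite mulr_sumr; apply: eq_bigr => j _; rewrite -mulr_suml -mulr_sumr Hpc.
    by ring.
  - by rewrite sumr_const card_ord mulr_natl.
  - congr (_ * _); apply: eq_bigr => i _; by rewrite mulr_suml.
  - congr (_ * _); apply: eq_bigr => i _; by rewrite mulr_suml.
have dual : \sum_(i < n) \sum_(l < n) q l * (if l == i then vb i else v l) ^+ 2
    = n%:R * (\sum_(i < n) ((b i + nu) * (vb i ^+ 2 - v i ^+ 2)))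
      + n%:R * (\sum_(i < n) q i * v i ^+ 2).
  have E i : \sum_(l < n) q l * (if l == i then vb i else v l) ^+ 2 =
     n%:R * ((b i + nu) * (vb i ^+ 2 - v i ^+ 2)) + \sum_(l < n) q l * v l ^+ 2.
    rewrite (bigD1 i) //= eqxx [in RHS](bigD1 i) //=.
    have -> : \sum_(l < n | l != i) q l * (if l == i then vb i else v l) ^+ 2 =
              \sum_(l < n | l != i) q l * v l ^+ 2.
      by apply: eq_bigr => l /negbTE ->.
    rewrite Hq; ring.
  under eq_bigr do rewrite E.
  rewrite big_split /= -mulr_sumr; congr (_ + _).
  by rewrite sumr_const card_ord mulr_natl.
rewrite big_split /= primal dual.
(* The extrapolation term splits into the bilinear terms of the dual and primal prox bounds, with
   signs that cancel them. *)
have cross : \sum_(i < n) \sum_(j < d) A i j * ub j * (vb i - v i) =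
    \sum_(i < n) (\sum_(j < d) A i j * ub j) * vb i -
    \sum_(j < d) (\sum_(i < n) A i j * v i) * ub j.
  rewrite [X in _ = _ - X](eq_bigr (fun j => \sum_(i < n) A i j * v i * ub j));
    last by move=> j _; rewrite mulr_suml.
  rewrite [X in _ = _ - X]exchange_big -sumrB /=.
  apply: eq_bigr => i _; rewrite mulr_suml -sumrB.
  by apply: eq_bigr => j _; ring.
rewrite cross.
have Sx : \sum_(j < d) (a j + mu) * (ub j ^+ 2 - u j ^+ 2) <=
   \sum_(j < d) (- (mu * u j ^+ 2)) -
     2 * \sum_(j < d) (\sum_(i < n) A i j * v i) * ub j.
  rewrite mulr_sumr -sumrB; apply: ler_sum => j _.
  by have := Hx j; rewrite mulrA; lra.
(* The quadratic extrapolation error is absorbed by the term [- b i * (vb i - v i) ^+ 2] of the dual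
   prox bound. *)
have Sy : \sum_(i < n) ((b i + nu) * (vb i ^+ 2 - v i ^+ 2)) +
    (\sum_(i < n) (\sum_(j < d) s j * A i j ^+ 2) * (vb i - v i) ^+ 2) <=
   \sum_(i < n) (- (nu * v i ^+ 2)) +
     2 * \sum_(i < n) (\sum_(j < d) A i j * ub j) * vb i.
  rewrite mulr_sumr -!big_split /=; apply: ler_sum => i _.
  have := ler_wpM2r (sqr_ge0 (vb i - v i)) (Hs i).
  have := Hy i; rewrite mulrA; lra.
have Kx : \sum_(j < d) (- (mu * u j ^+ 2)) <=
    - kappa^-1 * \sum_(j < d) p j * u j ^+ 2.
  rewrite mulr_sumr; apply: ler_sum => j _.
  rewrite mulNr lerN2 mulrA ler_wpM2r ?sqr_ge0// mulrC ler_pdivrMr// mulrC.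
  exact: Hp.
have Ky : \sum_(i < n) (- (nu * v i ^+ 2)) <=
    - kappa^-1 * \sum_(i < n) q i * v i ^+ 2.
  rewrite mulr_sumr; apply: ler_sum => i _.
  rewrite mulNr lerN2 mulrA ler_wpM2r ?sqr_ge0// mulrC ler_pdivrMr// mulrC.
  exact: Hqk.
move: Sx Sy Kx Ky.
set X1 := \sum_(j < d) _ * (_ - _); set X2 := \sum_(j < d) - _.
set X3 := \sum_(j < d) _ * ub j; set X4 := \sum_(i < n) _ * (_ - _).
set X5 := \sum_(i < n) _ * _ ^+ 2; set X6 := \sum_(i < n) - _.
set X7 := \sum_(i < n) _ * vb i; set X8 := \sum_(j < d) _ * _.
set X9 := \sum_(i < n) _ * _.
move=> Sx Sy Kx Ky.
have -> : n%:R * X1 + n%:R * X8 - n%:R * 2 * (X7 - X3) + n%:R * X5 +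
  (n%:R * X4 + n%:R * X9) =
  n%:R * (X1 + X8 - 2 * (X7 - X3) + X5 + (X4 + X9)) by ring.
apply: ler_wpM2l => //; nra.
Qed.

(** * Lower semicontinuity and existence of minimizers *)

(** Without a minimizer, the sublevel sets [B y0] generate a filter, and lower semicontinuity gives
    [F y < F x'] for [x'] near any [x] in [K] and [y] far along the filter. Compactness makes this
    uniform over [K], which is absurd at [x' = y = y0]. *)
Lemma lsc_compact_min (R : realType) (X : topologicalType) (K : set X)
    (F : X -> \bar R) :
  compact K -> K !=set0 -> lower_semicontinuous F ->
  exists2 x, K x & forall y, K y -> (F x <= F y)%E.
Proof.
move=> cK [x0 Kx0] lF; apply: contrapT => nomin.
have below x : K x -> exists2 y, K y & (F y < F x)%E.
  move=> Kx; apply: contrapT => H; apply: nomin; exists x => // y Ky.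
  by rewrite leNgt; apply/negP => yx; apply: H; exists y.
pose B y0 := [set y | K y /\ (F y <= F y0)%E].
have ffK : Filter (filter_from K B).
  apply: filter_from_filter; first by exists x0.
  move=> y1 y2 K1 K2; have [le12|lt21] := leP (F y1) (F y2).
    by exists y1 => // y [Ky yy1]; split; split => //; apply: le_trans le12.
  by exists y2 => // y [Ky yy2]; split; split => //;
    apply: le_trans (ltW lt21).
have /compact_near_coveringP/(_ X _ (fun y x => (F y < F x)%E) ffK) := cK.
case.
  move=> x Kx; have [y0 Ky0 y0x] := below x Kx.
  (* Lower semicontinuity only tests real levels; [F y0 = -oo] would make [y0] a minimizer. *)
  have y0fin : F y0 \is a fin_num.
    rewrite fin_numE; apply/andP; split; last first.
      by rewrite -ltey (lt_le_trans y0x) ?leey.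
    by apply/eqP => y0N; apply: nomin; exists y0 => // y _; rewrite y0N leNye.
  have [|V Vx HV] := lF x (fine (F y0)); first by rewrite fineK.
  exists (V, B y0); first by split => //=; exists y0.
  move=> [x' y] [/= Vx' [Ky yy0]].
  by apply: le_lt_trans yy0 _; rewrite -[F y0]fineK//; exact: HV.
move=> y0 Ky0 /(_ y0 (conj Ky0 (lexx _)) y0 Ky0).
by rewrite ltxx.
Qed.

Lemma lscD_continuous (R : realType) (X : topologicalType)
    (F : X -> \bar R) (h : X -> R) :
  lower_semicontinuous F -> continuous h ->
  lower_semicontinuous (fun x => (F x + (h x)%:E)%E).
Proof.
move=> lF ch x a aFx.
have [e e0 ltF] : exists2 e : R, 0 < e & ((a - h x + e)%:E < F x)%E.
  case: (F x) aFx => [r||//].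
  - rewrite -EFinD lte_fin => ar.
    by exists ((r + h x - a) / 2); [lra|rewrite lte_fin; lra].
  - by move=> _; exists 1; rewrite ?ltr01 ?ltry.
have [V Vx HV] := lF _ _ ltF.
have he : \forall y \near x, `|h x - h y| < e.
  by have /cvgrPdist_lt/(_ _ e0) := ch x.
exists (V `&` [set y | `|h x - h y| < e]); first exact: filterI.
move=> y [Vy /= hy]; have := HV _ Vy.
move: hy; rewrite ltr_norml => /andP[h1 h2].
case: (F y) => [r||//]; last by move=> _; rewrite addye // ltry.
by rewrite -EFinD !lte_fin; lra.
Qed.

(** * Proximal steps in one variable *)

Section Scalar.
Context (R : realType).
Implicit Types (f : R -> \bar R) (tau mu x v q : R).

(** The affine minorant of slope [q] at [v] makes the objective at least its value at [v] outside a
    segment centred at [v], so a minimizer over this compact segment is global. *)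
Lemma proxP f tau x v q : 0 < tau -> lower_semicontinuous f ->
  f v \is a fin_num -> subdifferential *%R f v q ->
  forall u, (f (prox tau f x) + ((2 * tau)^-1 * (prox tau f x - x) ^+ 2)%:E
     <= f u + ((2 * tau)^-1 * (u - x) ^+ 2)%:E)%E.
Proof.
move=> t0 lf fv Hq.
suff [p Hp] : exists p, forall u, (f p + ((2 * tau)^-1 * (p - x) ^+ 2)%:E
     <= f u + ((2 * tau)^-1 * (u - x) ^+ 2)%:E)%E.
  exact: (@xgetPex _ 0 [set p | forall u, (f p + _ <= f u + _)%E]
    (ex_intro _ p Hp)).
set c := (2 * tau)^-1; have c0 : 0 < c by rewrite invr_gt0 mulr_gt0.
pose h u : R := c * (u - x) ^+ 2.
have ch : continuous h.
  have ci : continuous (fun u : R => u - x).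
    by move=> u; apply: cvgB; [exact: cvg_id|exact: cvg_cst].
  by move=> u; apply: cvgM; [exact: cvg_cst|exact: (cvgM (ci u) (ci u))].
have lG := @lscD_continuous _ _ f h lf ch.
(* The objective grows from [v] to [u] by at least [w0 * (u - v) + c * (u - v) ^+ 2], which is
   nonnegative once [r <= |u - v|]. *)
pose w0 := q + 2 * c * (v - x); pose r := `|w0| / c.
have r0 : 0 <= r by rewrite divr_ge0 // ltW.
have vin : `[v - r, v + r]%classic v.
  by rewrite /= in_itv /=; apply/andP; split; lra.
have [p _ minp] := @lsc_compact_min _ _ _ _ (@segment_compact _ (v - r) (v + r))
  (ex_intro _ v vin) lG.
exists p => u /=.
have [uin|unotin] := pselect (`[v - r, v + r]%classic u); first exact: minp.
apply: le_trans (minp _ vin) _.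
have far : r < `|u - v|.
  rewrite ltNge; apply/negP; rewrite ler_norml => /andP[h1 h2].
  by apply: unotin; rewrite /= in_itv /=; apply/andP; split; lra.
have : `|w0| * `|u - v| <= c * (u - v) ^+ 2.
  rewrite -real_normK ?num_real // expr2 mulrA ler_wpM2r //.
  by move: far; rewrite /r ltr_pdivrMr // mulrC => /ltW.
have := ler_norm (- (w0 * (u - v))); rewrite normrN normrM => h1 h2.
have {h1 h2} key : 0 <= w0 * (u - v) + c * (u - v) ^+ 2 by lra.
have := Hq u; rewrite -(fineK fv); case: (f u) => [y||//].
  by rewrite -!EFinD !lee_fin /h => h1; move: key; rewrite /w0; nra.
by move=> _; rewrite addye // leey.
Qed.

(** Fermat's rule for the prox objective: the minimizer [p] is compared with [t u + (1 - t) p],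
    convexity bounds [f] there, and dividing by [t] leaves an error that vanishes with [t]. *)
Lemma prox_subdifferential f tau x v q : 0 < tau -> lower_semicontinuous f ->
  econvex (f : R^o -> \bar R) -> (forall u, f u != -oo%E) ->
  f v \is a fin_num -> subdifferential *%R f v q ->
  f (prox tau f x) \is a fin_num /\
  subdifferential *%R f (prox tau f x) ((x - prox tau f x) / tau).
Proof.
move=> t0 lf cf fN fv Hq; have := @proxP f tau x v q t0 lf fv Hq.
set p := prox tau f x; set c := (2 * tau)^-1 => Hp.
have c0 : 0 < c by rewrite invr_gt0 mulr_gt0.
have pfin : f p \is a fin_num.
  rewrite fin_numE fN /=; apply/eqP => fp.
  by have := Hp v; rewrite fp addye // -(fineK fv) -EFinD leye_eq.
split => // u; have := fN u; case fuE : (f u) => [y||//] _;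
  last by rewrite leey.
rewrite -(fineK pfin) -EFinD lee_fin; set z := fine (f p).
have ineq t : 0 < t < 1 ->
    z + (x - p) / tau * (u - p) <= y + t * (c * (u - p) ^+ 2).
  move=> t01; have := le_trans (Hp (t *: (u : R^o) + (1 - t) *: (p : R^o)))
    (leeD2r _ (cf u p t t01)).
  rewrite fuE -(fineK pfin) -/z -!EFinM -!EFinD lee_fin /GRing.scale /=.
  have -> : (x - p) / tau = 2 * c * (x - p).
    by rewrite /c invfM; field; rewrite gt_eqF.
  move: t01 => /andP[tp t1] H.
  rewrite -(ler_pM2l tp); nra.
apply/ler_addgt0Pr => e e0.
pose D := c * (u - p) ^+ 2.
have D0 : 0 <= D by rewrite mulr_ge0 ?sqr_ge0 // ltW.
(* Small enough that [t * D <= e]; [D + 1] keeps the quotient defined when [D = 0]. *)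
pose t := Num.min (1 / 2) (e / (D + 1)).
have tp : 0 < t.
  by rewrite lt_min; apply/andP; split; [lra|rewrite divr_gt0 //; lra].
have t1 : t < 1 by rewrite gt_min; apply/orP; left; lra.
have tD : t * D <= e.
  have : t * (D + 1) <= e.
    by rewrite -ler_pdivlMr; [rewrite ge_min lexx orbT|lra].
  by apply: le_trans; apply: ler_wpM2l; [exact: ltW|lra].
apply: le_trans (ineq t _) _; first by rewrite tp t1.
by rewrite lerD2l.
Qed.

Lemma strongly_monotone f mu (x y p q : R) :
  strongly_convex *%R mu f -> f x \is a fin_num -> f y \is a fin_num ->
  subdifferential *%R f x p -> subdifferential *%R f y q ->
  mu * (x - y) ^+ 2 <= (p - q) * (x - y).
Proof.
move=> sf fx fy Hp Hq.
have := sf x y q Hq; have := sf y x p Hp.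
rewrite -(fineK fx) -(fineK fy) -!EFinD !lee_fin; nra.
Qed.

(** Three-point inequality: strong monotonicity between the prox point [p] and [v], with
    [2 (x - p) (p - v)] expanded into squares. *)
Lemma prox_step f mu tau (x v q r : R) : 0 <= mu -> 0 < tau ->
  lower_semicontinuous f -> econvex (f : R^o -> \bar R) ->
  (forall u, f u != -oo%E) -> strongly_convex *%R mu f ->
  f v \is a fin_num -> subdifferential *%R f v q ->
  (tau^-1 + mu) * (prox tau f (x - tau * r) - v) ^+ 2 <=
  tau^-1 * (x - v) ^+ 2 - tau^-1 * (prox tau f (x - tau * r) - x) ^+ 2
  - 2 * (r + q) * (prox tau f (x - tau * r) - v).
Proof.
move=> mu0 t0 lf cf fN sf fv Hq.
have [pf Hp] := prox_subdifferential (x - tau * r) t0 lf cf fN fv Hq.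
have := strongly_monotone sf pf fv Hp Hq; set p := prox _ _ _.
have -> : (x - tau * r - p) / tau = tau^-1 * (x - p) - r.
  by field; rewrite gt_eqF.
(* Monotonicity gives the coefficient [tau^-1 + 2 * mu]; one copy of [mu * (p - v) ^+ 2] is
   dropped. *)
have := mulr_ge0 mu0 (sqr_ge0 (p - v)); nra.
Qed.

End Scalar.

(** * From a separable function to its components *)

Section Separable.
Context (R : realType) (m : nat).
Implicit Types (x y w : 'cV[R]_m) (j : 'I_m) (t v : R).

Definition upd x j t : 'cV[R]_m := \col_k (if k == j then t else x k 0).

Lemma upd_id x j : upd x j (x j 0) = x.
Proof. by apply/colP => k; rewrite mxE; case: eqP => [->|]. Qed.

Lemma updK x j v t : upd (upd x j v) j t = upd x j t.
Proof. by apply/colP => k; rewrite !mxE; case: eqP. Qed.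

Lemma upd_affine x j t : upd x j t = upd x j 0 + t *: delta_mx j 0.
Proof.
apply/colP => k; rewrite !mxE eqxx andbT.
by case: eqP => _; rewrite ?mulr1 ?mulr0 ?add0r ?addr0.
Qed.

Lemma upd_continuous x j : continuous (upd x j).
Proof.
have -> : upd x j = (fun t => upd x j 0 + t *: delta_mx j 0).
  by apply/funext => t; rewrite upd_affine.
by move=> t; apply: cvgD; [exact: cvg_cst|exact: scalel_continuous].
Qed.

Lemma dotp_upd w x j t : dotp w (upd x j t - x) = w j 0 * (t - x j 0).
Proof.
rewrite /dotp (bigD1 j) //= !mxE eqxx big1 ?addr0 // => k /negbTE kj.
by rewrite !mxE kj subrr mulr0.
Qed.

Context (F : 'cV[R]_m -> \bar R) (f : 'I_m -> R -> \bar R).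
Hypothesis FE : forall x, F x = (\sum_(j < m) f j (x j 0%R))%E.
Hypothesis properF : proper F.

Lemma component_fin x j : F x \is a fin_num -> f j (x j 0) \is a fin_num.
Proof. by rewrite FE => /sum_fin_numP; apply => //; rewrite mem_index_enum. Qed.

(** Along a coordinate line through a point of finite value, [F] is [f j] up to a real constant.
    Cancelling that constant transfers properties of [F] to its components. *)
Lemma sum_upd x j : F x \is a fin_num ->
  exists c, forall t, F (upd x j t) = (f j t + c%:E)%E.
Proof.
move=> Fx; exists (\sum_(k < m | k != j) fine (f k (x k 0%R))) => t.
rewrite FE (bigD1 j) //= mxE eqxx EFin_sum_fine; last first.
  by move=> k _; exact: component_fin.
by congr (_ + _)%E; apply: eq_bigr => k /negbTE kj; rewrite mxE kj.
Qed.

Lemma proper_fin : exists x, F x \is a fin_num.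
Proof. by case: properF => FN [x Fx]; exists x; rewrite fin_numE FN. Qed.

Lemma component_neqNy j t : f j t != -oo%E.
Proof.
have [x /sum_upd-/(_ j)[c Fc]] := proper_fin.
by have := properF.1 (upd x j t); rewrite Fc; apply: contra => /eqP ->.
Qed.

Lemma component_convex j : econvex F -> econvex (f j : R^o -> \bar R).
Proof.
move=> cF u v t t01; have [x /sum_upd-/(_ j)[c Fc]] := proper_fin.
have E : t *: upd x j u + (1 - t) *: upd x j v =
         upd x j (t *: (u : R^o) + (1 - t) *: (v : R^o)).
  apply/colP => k; rewrite !mxE; case: eqP => _ //.
  by rewrite -mulrDl subrKC mul1r.
have := cF (upd x j u) (upd x j v) t t01; rewrite E !Fc.
have [t0 t1] := andP t01.
have t1' : 0 < 1 - t by rewrite subr_gt0.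
have := component_neqNy j u; have := component_neqNy j v.
have := component_neqNy j (t *: (u : R^o) + (1 - t) *: (v : R^o)).
case: (f j _) => [a||] // _; case: (f j v) => [b||] // _;
  case: (f j u) => [b'||] // _;
  rewrite ?gt0_muley ?lte_fin // ?addye ?addey ?leey // -?EFinM ?lee_fin //.
by lra.
Qed.

Lemma component_lsc j : lower_semicontinuous F -> lower_semicontinuous (f j).
Proof.
move=> lF t a aft; have [x /sum_upd-/(_ j)[c Fc]] := proper_fin.
have [|V Vx HV] := lF (upd x j t) (a + c).
  by rewrite Fc EFinD lteD2rE.
exists (upd x j @^-1` V); first exact: upd_continuous.
by move=> s /HV; rewrite Fc EFinD lteD2rE.
Qed.

Lemma component_subdifferential x (Q : 'cV[R]_m) j : F x \is a fin_num ->
  subdifferential (@dotp R m) F x Q ->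
  subdifferential *%R (f j) (x j 0) (Q j 0).
Proof.
move=> Fx HQ t; have [c Fc] := sum_upd j Fx.
have := HQ (upd x j t); rewrite dotp_upd Fc -{1}(upd_id x j) Fc.
by rewrite addeAC leeD2rE.
Qed.

Lemma sum_subdifferential x (Q : 'cV[R]_m) :
  (forall j, subdifferential *%R (f j) (x j 0) (Q j 0)) ->
  subdifferential (@dotp R m) F x Q.
Proof.
move=> HQ u; rewrite !FE /dotp -sumEFin -big_split /=.
by apply: lee_sum => j _; rewrite !mxE; exact: HQ.
Qed.

(** Strong convexity of [F] speaks of its own subgradients, so a subgradient [q] of [f j] must be
    extended to one of [F]; [Q] supplies the other coordinates. *)
Lemma component_strongly_convex mu x (Q : 'cV[R]_m) j : F x \is a fin_num ->
  subdifferential (@dotp R m) F x Q ->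
  strongly_convex (@dotp R m) mu F -> strongly_convex *%R mu (f j).
Proof.
move=> Fx HQ sF t v q Hq; have [c Fc] := sum_upd j Fx.
have HQ' : subdifferential (@dotp R m) F (upd x j v) (upd Q j q).
  apply: sum_subdifferential => k; rewrite !mxE; case: eqP => [->//|_].
  exact: component_subdifferential.
have := sF (upd x j t) _ _ HQ'; rewrite -(updK x j v t) !dotp_upd !mxE eqxx.
by rewrite !updK !Fc addeAC leeD2rE.
Qed.

End Separable.

(** * Optimality conditions at a saddle point *)

Section Bilinear.
Context (R : realType).

Lemma dotpBr (m : nat) (u x y : 'cV[R]_m) :
  dotp u (x - y) = dotp u x - dotp u y.
Proof. by rewrite /dotp -sumrB; apply: eq_bigr => i _; rewrite !mxE mulrBr. Qed.

Lemma dotpNl (m : nat) (u x : 'cV[R]_m) : dotp (- u) x = - dotp u x.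
Proof. by rewrite /dotp -sumrN; apply: eq_bigr => i _; rewrite mxE mulNr. Qed.

Lemma dotp_trmx (n d : nat) (A : 'M[R]_(n, d)) x y :
  dotp (A *m x) y = dotp (A^T *m y) x.
Proof.
rewrite /dotp; under eq_bigr do rewrite mxE mulr_suml.
under [RHS]eq_bigr do rewrite mxE mulr_suml.
rewrite exchange_big; apply: eq_bigr => j _; apply: eq_bigr => i _.
by rewrite mxE mulrAC.
Qed.

End Bilinear.

Section Saddle.
Context (R : realType) (n d : nat) (A : 'M[R]_(n, d)).
Context (g : 'cV[R]_d -> \bar R) (hs : 'cV[R]_n -> \bar R).
Context (xs : 'cV[R]_d) (ys : 'cV[R]_n).
Hypotheses (pg : proper g) (ph : proper hs) (sp : saddle_point A g hs xs ys).

(** If [hs ys = +oo], the Lagrangian at the saddle is [-oo] whatever [g xs] is, and a point of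
    finite [hs] does better. Once [hs ys] is finite, [g xs = +oo] is excluded by a point of finite
    [g]. *)
Lemma saddle_fin : g xs \is a fin_num /\ hs ys \is a fin_num.
Proof.
have [gN [x gx]] := pg; have [hN [y hy]] := ph.
have hsfin : hs ys \is a fin_num.
  rewrite fin_numE hN /=; apply/eqP => h1; have [_] := sp xs y.
  rewrite /lagrangian h1 /= addNye; apply/negP; rewrite -ltNge ltNye.
  move: hy (hN y) (gN xs); case: (hs y) => [b||] //; case: (g xs) => [a||] //.
split => //; rewrite fin_numE gN /=; apply/eqP => g1; have [+ _] := sp x ys.
rewrite /lagrangian g1 -(fineK hsfin) -EFinB addey // leye_eq.
by move: gx (gN x); case: (g x).
Qed.

Lemma saddle_subdifferential :
  subdifferential (@dotp R d) g xs (- (A^T *m ys)) /\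
  subdifferential (@dotp R n) hs ys (A *m xs).
Proof.
have [gf hf] := saddle_fin; have [gN _] := pg; have [hN _] := ph.
split => [x|y].
- have [+ _] := sp x ys; move: (gN x); rewrite /lagrangian.
  rewrite -(fineK gf) -(fineK hf); case: (g x) => [a||] // _; last first.
    by move=> _; rewrite leey.
  rewrite -!EFinB -!EFinD !lee_fin (dotp_trmx A xs) (dotp_trmx A x).
  by rewrite dotpNl dotpBr; lra.
- have [_] := sp xs y; move: (hN y); rewrite /lagrangian.
  rewrite -(fineK gf) -(fineK hf); case: (hs y) => [a||] // _; last first.
    by move=> _; rewrite leey.
  rewrite -!EFinB -!EFinD !lee_fin dotpBr; lra.
Qed.

End Saddle.

(** * Expectation along random index sequences *)

Lemma sum_tuple_cons (V : nmodType) (I : finType) (k : nat)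
    (G : k.+1.-tuple I -> V) :
  \sum_t G t = \sum_i \sum_(t : k.-tuple I) G [tuple of i :: t].
Proof.
rewrite pair_big /= (reindex (fun p : I * k.-tuple I => [tuple of p.1 :: p.2])).
  by apply: eq_bigr => -[].
exists (fun t => (thead t, [tuple of behead t])) => [[i t] _|t _] /=.
  by congr pair; apply/val_inj.
by rewrite -tuple_eta.
Qed.

Section RandomIteration.
Context (R : realType) (dT : measure_display) (T : measurableType dT).
Context (P : probability T R) (n : nat) (idx : nat -> T -> 'I_n).
Context (S : Type) (step : 'I_n -> S -> S).
Hypotheses (n0 : (0 < n)%N) (iid : iid_uniform P idx).
Variables (Z : nat -> T -> S) (s0 : S).
Hypotheses (Z0 : forall w, Z 0%N w = s0)
  (ZS : forall k w, Z k.+1 w = step (idx k w) (Z k w)).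
Let run (s : S) (t : seq 'I_n) : S := foldl (fun s i => step i s) s t.

(** Indexing by [iota 0 k] matches the independence clause of [iid_uniform]. *)
Let prefix_event k (t : k.-tuple 'I_n) : set T :=
  [set w | forall l, l \in iota 0 k -> idx l w = nth (Ordinal n0) t l].

Let prefix_eventP k (t : k.-tuple 'I_n) w :
  prefix_event t w <-> mkseq (fun l => idx l w) k = t.
Proof.
split => [H|E l].
  apply: (@eq_from_nth _ (Ordinal n0)); first by rewrite size_mkseq size_tuple.
  move=> l; rewrite size_mkseq => lk; rewrite nth_mkseq //.
  by apply: H; rewrite mem_iota.
by rewrite mem_iota /= add0n => lk; rewrite -E nth_mkseq.
Qed.

Let Z_run k w : Z k w = run s0 (mkseq (fun l => idx l w) k).
Proof.
by elim: k => [|k IH]; rewrite ?Z0 // ZS IH mkseqS /run foldl_rcons.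
Qed.

Let measurable_prefix k (t : k.-tuple 'I_n) : measurable (prefix_event t).
Proof.
have -> : prefix_event t = \bigcap_(l in [set` iota 0 k])
    [set w | idx l w = nth (Ordinal n0) t l] by [].
by apply: fin_bigcap_measurable => // l _; case: iid.
Qed.

Let prob_prefix k (t : k.-tuple 'I_n) : P (prefix_event t) = (n%:R^-1 ^+ k)%:E.
Proof.
have [_ Pi Pp] := iid; rewrite /prefix_event Pp ?iota_uniq //.
under eq_bigr do rewrite Pi.
by rewrite prodEFin big_const_seq count_predT size_iota -Monoid.iteropE.
Qed.

(** The state after [k] steps depends only on the first [k] indices, so it is constant on each of
    the [n ^ k] prefix events, all of probability [n ^ (- k)]: the expectation is a finite
    average. *)
Lemma expectation_iterate (Phi : S -> R) k : (forall s, 0 <= Phi s) ->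
  ('E_P[fun w => Phi (Z k w)] =
  (n%:R^-1 ^+ k * \sum_(t : k.-tuple 'I_n) Phi (run s0 t))%:E)%E.
Proof.
move=> Phi0; have E w : (Phi (Z k w))%:E = (\sum_(t : k.-tuple 'I_n)
    (Phi (run s0 t))%:E * (\1_(prefix_event t) w)%:E)%E.
  have sz : size (mkseq (fun l => idx l w) k) == k by rewrite size_mkseq.
  rewrite (bigD1 (Tuple sz)) //= indicE mem_set; last exact/prefix_eventP.
  rewrite mule1 big1 ?adde0 ?Z_run // => t tn.
  rewrite indicE memNset ?mule0 // => /prefix_eventP E.
  by move/eqP: tn; apply; apply/val_inj; rewrite /= E.
rewrite unlock; under eq_integral do rewrite E.
rewrite ge0_integral_sum //; last 2 first.
  - move=> t; apply: measurable_funeM; apply/measurable_EFinP.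
    exact: measurable_indic.
  - by move=> t w _; rewrite mule_ge0 // lee_fin ?Phi0.
rewrite mulr_sumr -sumEFin; apply: eq_bigr => t _.
rewrite ge0_integralZl_EFin //; last first.
  by apply/measurable_EFinP; exact: measurable_indic.
rewrite EFinM muleC integral_indic // setIT; congr (_ * _)%E.
exact: prob_prefix.
Qed.

Lemma expectation_contraction (Psi Phi : S -> R) rho : 0 <= rho ->
  (forall s, 0 <= Psi s <= Phi s) ->
  (forall s, \sum_(i < n) Phi (step i s) <= n%:R * (rho * Phi s)) ->
  forall k, ('E_P[fun w => Psi (Z k w)] <= (rho ^+ k * Phi s0)%:E)%E.
Proof.
move=> rho0 PsiPhi contr k; rewrite expectation_iterate; last first.
  by move=> s; case/andP: (PsiPhi s).
rewrite lee_fin.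
have nR : 0 < n%:R :> R by rewrite ltr0n.
rewrite exprVn mulrC ler_pdivrMr ?exprn_gt0 // mulrC.
apply: le_trans (_ : \sum_(t : k.-tuple 'I_n) Phi (run s0 t) <= _).
  by apply: ler_sum => t _; case/andP: (PsiPhi (run s0 t)).
(* The start is generalized: the first index is peeled off, the induction hypothesis runs from
   [step i s], and the one-step bound sums over [i]. This replaces conditional expectations. *)
elim: k s0 => [|k IH] s.
  rewrite !expr0 !mul1r (big_pred1 ([tuple] : 0.-tuple 'I_n)) // => t.
  by apply/esym/eqP; exact: tuple0.
rewrite sum_tuple_cons.
apply: le_trans (_ : \sum_(i < n) n%:R ^+ k * (rho ^+ k * Phi (step i s)) <= _).
  by apply: ler_sum => i _; exact: IH.
rewrite -!mulr_sumr !exprSr.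
have -> : n%:R ^+ k * n%:R * (rho ^+ k * rho * Phi s) =
  n%:R ^+ k * (rho ^+ k * (n%:R * (rho * Phi s))) by ring.
by rewrite !ler_wpM2l ?exprn_ge0 // ltW.
Qed.

End RandomIteration.

(** * Number of iterations for a given accuracy *)

(** With [L = ln (1 + D / eps)] and [k >= kappa * L], [(1 - kappa^-1) ^+ k <= exp (- L)], and
    [exp (- L) * D = eps * D / (eps + D)]. *)
Lemma iterations_for_accuracy (R : realType) (kappa D eps : R) :
  1 <= kappa -> 0 <= D -> 0 < eps ->
  exists K : nat, K%:R <= 3 * (kappa * ln (1 + D / eps)) /\
    forall k, (K <= k)%N -> (1 - kappa^-1) ^+ k * D <= eps.
Proof.
move=> k1 D0 e0; have kp : 0 < kappa by lra.
have rho0 : 0 <= 1 - kappa^-1 by rewrite subr_ge0 invf_le1.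
have rho1 : 1 - kappa^-1 <= 1 by rewrite gerBl invr_ge0 ltW.
have De : 0 <= D / eps by rewrite divr_ge0 // ltW.
have L0 : 0 <= ln (1 + D / eps) by rewrite ln_ge0 // lerDl.
have [Dle|Dgt] := leP D eps.
  exists 0%N; split; first by rewrite !mulr_ge0 // ltW.
  by move=> k _; apply: le_trans Dle; rewrite ler_piMl // exprn_ile1.
set L := ln (1 + D / eps) in L0 *.
(* Here [1 + D / eps > 2 >= exp (1 / 2)]. As [kappa >= 1], rounding up costs at most
   [2 * kappa * L], whence the factor 3. *)
have Lhalf : 1 <= 2 * L.
  have : (2^-1 : R) <= expR (- 2^-1).
    by have := expR_ge1Dx (- 2^-1 : R); lra.
  rewrite expRN invf_pge ?posrE ?expR_gt0 // => h.
  rewrite -ler_pdivrMl // mulr1 -ler_expR lnK ?posrE; last by lra.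
  apply: le_trans h _; rewrite invrK.
  by have : 1 < D / eps by [rewrite ltr_pdivlMr // mul1r]; lra.
have kL : 0 <= kappa * L by rewrite mulr_ge0 // ltW.
exists (Num.trunc (kappa * L)).+1; split.
  have /andP[h _] := truncn_itv kL; rewrite -addn1 natrD.
  by have : 1 * 1 <= kappa * (2 * L) by [apply: ler_pM]; lra.
move=> k Kk.
have kge : kappa * L <= k%:R.
  by rewrite ltW // (lt_le_trans (truncnS_gt _)) // ler_nat.
have : (1 - kappa^-1) ^+ k <= expR (- L).
  apply: le_trans (_ : expR (- kappa^-1) ^+ k <= _).
    by rewrite lerXn2r ?nnegrE ?expR_ge0 // expR_ge1Dx.
  by rewrite -expRM_natl ler_expR mulrN lerN2 ler_pdivlMr // mulrC.
move=> /(ler_wpM2r D0) /le_trans; apply.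
rewrite expRN lnK ?posrE; last by lra.
have -> : (1 + D / eps)^-1 * D = eps * (D / (eps + D)).
  by field; rewrite !gt_eqF //; lra.
by rewrite ler_piMr ?(ltW e0) // ler_pdivrMr; lra.
Qed.

(** * Norms, sparsity counts and bounds on the step sizes *)

Lemma enorm_sqr (R : realType) (m : nat) (u : 'cV[R]_m) :
  enorm u ^+ 2 = \sum_(i < m) u i 0 ^+ 2.
Proof.
rewrite /enorm sqr_sqrtr; last first.
  by apply: sumr_ge0 => i _; rewrite -expr2 sqr_ge0.
by apply: eq_bigr => i _; rewrite expr2.
Qed.

Lemma nnzE (R : realType) (n d : nat) (A : 'M[R]_(n, d)) :
  nnz A = (\sum_(i < n) #|row_supp A i|)%N.
Proof.
rewrite /nnz -sum1dep_card.
under [RHS]eq_bigr do rewrite /row_supp -sum1dep_card.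
by rewrite pair_big_dep /=.
Qed.

Section StepSizeBounds.
Context (R : realType) (n d : nat) (A : 'M[R]_(n, d)) (mug muh : R).
Hypotheses (n0 : (0 < n)%N) (mug0 : 0 < mug) (muh0 : 0 < muh).
Hypothesis rowA : forall i, row_supp A i != finset.set0.
Hypothesis colA : forall j, col_supp A j != finset.set0.

Local Notation m := (max_row_norm A).
Local Notation tau := (pcd_tau A mug muh).
Local Notation sigma := (pcd_sigma A mug muh).
Local Notation theta := (pcd_theta A mug muh).
Local Notation c j := (#|col_supp A j|%:R : R).
Local Notation sg := (Num.sqrt mug).
Local Notation sh := (Num.sqrt muh).
(** Multiplied by [nnz A / n], the expected cost of an iteration, it gives the factor of the
    complexity bound. *)
Definition condition_number : R :=
  n%:R + n%:R * (max_row_norm A / Num.sqrt (muh * mug)).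
Local Notation kappa := condition_number.

Let sg0 : 0 < sg. Proof. by rewrite sqrtr_gt0. Qed.
Let sh0 : 0 < sh. Proof. by rewrite sqrtr_gt0. Qed.
Let sgE : mug = sg ^+ 2. Proof. by rewrite sqr_sqrtr // ltW. Qed.
Let shE : muh = sh ^+ 2. Proof. by rewrite sqr_sqrtr // ltW. Qed.
Let nR : 0 < n%:R :> R. Proof. by rewrite ltr0n. Qed.

Lemma row_norm_sqr i : row_norm A i ^+ 2 = \sum_(j < d) A i j ^+ 2.
Proof. by rewrite /row_norm enorm_sqr; apply: eq_bigr => j _; rewrite !mxE. Qed.

Lemma row_norm_gt0 i : 0 < row_norm A i.
Proof.
rewrite lt_neqAle sqrtr_ge0 andbT eq_sym -sqrf_eq0 row_norm_sqr.
have [j] := set0Pn _ (rowA i); rewrite inE => Aij.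
rewrite psumr_eq0 => [|k _]; last exact: sqr_ge0.
by apply/allPn; exists j; rewrite ?mem_index_enum // sqrf_eq0.
Qed.

Lemma row_norm_le_max i : row_norm A i <= m.
Proof. exact: le_bigmax. Qed.

Lemma max_row_norm_gt0 : 0 < m.
Proof. exact: lt_le_trans (row_norm_gt0 (Ordinal n0)) (row_norm_le_max _). Qed.

Lemma card_col_ge1 j : 1 <= c j.
Proof. by rewrite ler1n card_gt0. Qed.

Lemma card_colE j : \sum_(i < n) (A i j != 0)%:R = c j.
Proof.
rewrite /col_supp -sum1dep_card natr_sum [RHS]big_mkcond.
by apply: eq_bigr => i _; case: ifP.
Qed.

Lemma col_probE j : col_prob A j = c j / n%:R. Proof. by []. Qed.

Lemma pcd_tauE j : tau j = sh / (sg * m * c j).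
Proof. by rewrite /pcd_tau -mulrA col_probE divfK ?gt_eqF. Qed.

Let c0 j : 0 < c j. Proof. exact: lt_le_trans (card_col_ge1 j). Qed.

Lemma pcd_tau_gt0 j : 0 < tau j.
Proof. by rewrite pcd_tauE divr_gt0 // !mulr_gt0 // max_row_norm_gt0. Qed.

Lemma pcd_sigma_gt0 i : 0 < sigma i.
Proof. by rewrite divr_gt0 // !mulr_gt0 // row_norm_gt0. Qed.

Let mu_tau j : 0 < 1 + mug * tau j.
Proof. by rewrite addr_gt0 // mulr_gt0 // pcd_tau_gt0. Qed.

Lemma primal_weightE j :
  primal_weight A mug muh j = n%:R * ((tau j)^-1 + mug) / c j.
Proof.
have := pcd_tau_gt0 j; rewrite /primal_weight col_probE => t0.
by field; rewrite !gt_eqF.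
Qed.

Lemma dual_weightE i :
  dual_weight A mug muh i = n%:R * ((sigma i)^-1 + muh).
Proof.
have := pcd_sigma_gt0 i; rewrite /dual_weight => t0.
by field; rewrite gt_eqF.
Qed.

Lemma primal_weight_gt0 j : 0 < primal_weight A mug muh j.
Proof.
rewrite primal_weightE divr_gt0 // mulr_gt0 // addr_gt0 // invr_gt0.
exact: pcd_tau_gt0.
Qed.

Lemma dual_weight_gt0 i : 0 < dual_weight A mug muh i.
Proof.
by rewrite dual_weightE mulr_gt0 // addr_gt0 // invr_gt0 pcd_sigma_gt0.
Qed.

(** This normalization dictates [theta]: it gives the extrapolation term the same coefficient in all
    columns. *)
Lemma primal_weight_theta j :
  primal_weight A mug muh j * (tau j * theta j) = n%:R.
Proof.
have := pcd_tau_gt0 j; rewrite /primal_weight /pcd_theta col_probE => t0.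
by field; rewrite !gt_eqF.
Qed.

Let sqrt_mu : Num.sqrt (muh * mug) = sh * sg.
Proof. by rewrite sqrtrM // ltW. Qed.

(** The column count in [tau] cancels in [1 / (tau j * c j)], which yields the second term of
    [kappa] exactly; the first follows from [c j >= 1]. *)
Lemma primal_weight_le j : primal_weight A mug muh j <= kappa * mug.
Proof.
rewrite primal_weightE pcd_tauE /condition_number sqrt_mu.
have m0 := max_row_norm_gt0; set M := m in m0 *.
have -> : n%:R * ((sh / (sg * M * c j))^-1 + mug) / c j =
   n%:R * (sg * M / sh) + n%:R * mug / c j.
  by field; rewrite !gt_eqF.
have -> : (n%:R + n%:R * (M / (sh * sg))) * mug =
   n%:R * (sg * M / sh) + n%:R * mug.
  by rewrite sgE sqrtr_sqr gtr0_norm //; field; rewrite !gt_eqF.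
by rewrite lerD2l ler_pdivrMr // ler_peMr ?card_col_ge1 // mulr_ge0 // ltW.
Qed.

Lemma dual_weight_le i : dual_weight A mug muh i <= kappa * muh.
Proof.
rewrite dual_weightE /condition_number sqrt_mu /pcd_sigma.
have a0 := row_norm_gt0 i; have am := row_norm_le_max i.
have m0 := max_row_norm_gt0; set M := m in m0 am *.
have -> : n%:R * ((sg / (sh * row_norm A i))^-1 + muh) =
   n%:R * muh + n%:R * sh / sg * row_norm A i.
  by field; rewrite !gt_eqF.
have -> : (n%:R + n%:R * (M / (sh * sg))) * muh =
   n%:R * muh + n%:R * sh / sg * M.
  by rewrite shE sqrtr_sqr gtr0_norm //; field; rewrite !gt_eqF.
by rewrite lerD2l ler_wpM2l // !mulr_ge0 // ?invr_ge0 ltW.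
Qed.

(** The step-size condition: [tau j * theta j <= tau j * c j = sh / (sg * m)], so the sum is at most
    [sh / (sg * m) * row_norm A i ^+ 2], and one row norm is bounded by [m]. *)
Lemma tau_theta_le i :
  \sum_(j < d) tau j * theta j * A i j ^+ 2 <= (sigma i)^-1.
Proof.
have a0 := row_norm_gt0 i; have am := row_norm_le_max i.
have m0 := max_row_norm_gt0.
have tt j : tau j * theta j <= sh / (sg * m).
  have -> : sh / (sg * m) = tau j * c j.
    by rewrite pcd_tauE; field; rewrite !gt_eqF.
  rewrite ler_pM2l ?pcd_tau_gt0 // /pcd_theta col_probE divfK ?gt_eqF //.
  rewrite ler_pdivrMr // ler_peMr ?(ltW (c0 j)) // lerDl.
  by rewrite mulr_ge0 // ltW // pcd_tau_gt0.
apply: le_trans (_ : \sum_(j < d) sh / (sg * m) * A i j ^+ 2 <= _).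
  by apply: ler_sum => j _; apply: ler_wpM2r; rewrite ?sqr_ge0.
rewrite -mulr_sumr -row_norm_sqr /pcd_sigma.
have -> : sh / (sg * m) * row_norm A i ^+ 2 =
  sh / sg * row_norm A i * (row_norm A i / m) by field; rewrite !gt_eqF.
have -> : (sg / (sh * row_norm A i))^-1 = sh / sg * row_norm A i.
  by field; rewrite !gt_eqF.
rewrite ler_piMr ?ler_pdivrMr ?mul1r // !mulr_ge0 // ?invr_ge0 ltW //.
Qed.

Lemma condition_number_ge1 : 1 <= kappa.
Proof.
apply: le_trans (_ : n%:R <= _); first by rewrite ler1n.
by rewrite lerDl mulr_ge0 // divr_ge0 ?sqrtr_ge0 // ltW // max_row_norm_gt0.
Qed.

Lemma weighted_dist2_ge x xs y ys :
  enorm (x - xs) ^+ 2 + enorm (y - ys) ^+ 2 <=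
  weighted_dist2 A mug muh x xs y ys.
Proof.
rewrite /weighted_dist2 !enorm_sqr mulrDr !mulr_sumr.
apply: lerD; apply: ler_sum => j _; rewrite !mxE mulrA ler_peMl ?sqr_ge0 //.
  rewrite -ler_pdivrMr ?primal_weight_gt0 // mul1r le_max.
  apply/orP; left.
  exact: (le_bigmax _ (fun j => (primal_weight A mug muh j)^-1)).
rewrite -ler_pdivrMr ?dual_weight_gt0 // mul1r le_max.
apply/orP; right.
exact: (le_bigmax _ (fun j => (dual_weight A mug muh j)^-1)).
Qed.

End StepSizeBounds.

(** * Uniqueness of the saddle point and contraction of one iteration *)

Section Method.
Context (R : realType) (n d : nat) (A : 'M[R]_(n, d)).
Context (g : 'cV[R]_d -> \bar R) (g_ : 'I_d -> R -> \bar R).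
Context (hs : 'cV[R]_n -> \bar R) (hs_ : 'I_n -> R -> \bar R).
Context (mug muh : R) (xs : 'cV[R]_d) (ys : 'cV[R]_n).
Hypotheses (n0 : (0 < n)%N) (mug0 : 0 < mug) (muh0 : 0 < muh).
Hypothesis rowA : forall i, row_supp A i != finset.set0.
Hypothesis colA : forall j, col_supp A j != finset.set0.
Hypotheses (pg : proper g) (cg : econvex g) (lg : lower_semicontinuous g).
Hypotheses (ph : proper hs) (ch : econvex hs) (lh : lower_semicontinuous hs).
Hypothesis gE : forall x, g x = (\sum_(j < d) g_ j (x j 0%R))%E.
Hypothesis hE : forall y, hs y = (\sum_(i < n) hs_ i (y i 0%R))%E.
Hypothesis sg : strongly_convex (@dotp R d) mug g.
Hypothesis sh : forall i, strongly_convex *%R muh (hs_ i).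
Hypothesis sp : saddle_point A g hs xs ys.

Let component_strongly_convex_g j : strongly_convex *%R mug (g_ j).
Proof.
have [gf _] := saddle_fin pg ph sp.
have [Hg _] := saddle_subdifferential pg ph sp.
exact: (component_strongly_convex gE gf Hg sg).
Qed.

Lemma saddle_components x y : saddle_point A g hs x y ->
  (forall j, g_ j (x j 0) \is a fin_num /\
     subdifferential *%R (g_ j) (x j 0) (- (A^T *m y) j 0)) /\
  (forall i, hs_ i (y i 0) \is a fin_num /\
     subdifferential *%R (hs_ i) (y i 0) ((A *m x) i 0)).
Proof.
move=> sxy; have [gf hf] := saddle_fin pg ph sxy.
have [Hg Hh] := saddle_subdifferential pg ph sxy.
split => [j|i]; split.
- exact: (component_fin gE).
- by have := component_subdifferential gE j gf Hg; rewrite mxE.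
- exact: (component_fin hE).
- exact: (component_subdifferential hE i hf Hh).
Qed.

(** Strong monotonicity is summed over all components; the subgradients [- A^T y] and [A x] pair to
    zero by skew symmetry, so the weighted squared distance of two saddle points is at most 0. *)
Lemma saddle_unique x y : saddle_point A g hs x y -> x = xs /\ y = ys.
Proof.
move=> sxy; have [Hx Hy] := saddle_components sxy.
have [Hxs Hys] := saddle_components sp.
have sum_le0 : \sum_(j < d) mug * (x j 0 - xs j 0) ^+ 2 +
               \sum_(i < n) muh * (y i 0 - ys i 0) ^+ 2 <= 0.
  have cross : dotp (- (A^T *m (y - ys))) (x - xs) +
               dotp (A *m (x - xs)) (y - ys) = 0.
    by rewrite dotpNl (dotp_trmx A) addNr.
  rewrite -[leRHS]cross; apply: lerD; apply: ler_sum => k _.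
    have [fx sx] := Hx k; have [fxs sxs] := Hxs k.
    have := strongly_monotone (component_strongly_convex_g (j := k))
      fx fxs sx sxs.
    by rewrite mulmxBr !mxE opprD.
  have [fy sy] := Hy k; have [fys sys] := Hys k.
  have := strongly_monotone (sh (i := k)) fy fys sy sys.
  by rewrite mulmxBr !mxE.
have pos m mu (u v : 'cV[R]_m) : 0 < mu ->
    0 <= \sum_(j < m) mu * (u j 0 - v j 0) ^+ 2.
  by move=> mu0; apply: sumr_ge0 => j _; rewrite mulr_ge0 ?sqr_ge0 ?ltW.
have eq0 m mu (u v : 'cV[R]_m) : 0 < mu ->
    \sum_(j < m) mu * (u j 0 - v j 0) ^+ 2 <= 0 -> u = v.
  move=> mu0 le0; apply/colP => j.
  have /eqP := le_anti (introT andP (conj le0 (pos _ _ u v mu0))).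
  rewrite psumr_eq0 => [/allP/(_ j (mem_index_enum _))|k _]; last first.
    by rewrite mulr_ge0 ?sqr_ge0 ?ltW.
  by rewrite /= mulf_eq0 gt_eqF //= sqrf_eq0 subr_eq0 => /eqP.
have px := pos _ _ x xs mug0; have py := pos _ _ y ys muh0.
by split; [apply: (eq0 _ _ _ _ mug0)|apply: (eq0 _ _ _ _ muh0)]; lra.
Qed.

Local Notation tau := (pcd_tau A mug muh).
Local Notation sigma := (pcd_sigma A mug muh).
Local Notation theta := (pcd_theta A mug muh).
Local Notation kappa := (condition_number A mug muh).
Local Notation dist2 x y := (weighted_dist2 A mug muh x xs y ys).

Lemma pure_cd_step_contraction (z : 'cV[R]_d * 'cV[R]_n) :
  \sum_(i < n) (let z' := pure_cd_step A g_ hs_ tau sigma theta i z in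
                dist2 z'.1 z'.2) <=
  n%:R * ((1 - kappa^-1) * dist2 z.1 z.2).
Proof.
case: z => x y.
have [Hxs Hys] := saddle_components sp.
(* [xb] and [yb] form the full prox step from [(x, y)], independent of the sampled row. *)
pose xb j := prox (tau j) (g_ j) (x j 0 - tau j * (A^T *m y) j 0).
pose Axb i := \sum_(j < d) A i j * xb j.
pose yb i := prox (sigma i) (hs_ i) (y i 0 + sigma i * Axb i).
pose P j := primal_weight A mug muh j; pose Q i := dual_weight A mug muh i.
have step i : pure_cd_step A g_ hs_ tau sigma theta i (x, y) =
  (\col_j (if A i j != 0
           then xb j - tau j * theta j * A i j * (yb i - y i 0) else x j 0),
   \col_l (if l == i then yb i else y l 0)).
  rewrite /pure_cd_step.
  set X := \col_j (if j \in row_supp A i then xb j else x j 0).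
  (* [X] and [xb] differ only where [A i j = 0]. *)
  have AX : (A *m X) i 0 = Axb i.
    rewrite mxE; apply: eq_bigr => j _; rewrite mxE inE.
    by case: eqVneq => [->|//]; rewrite !mul0r.
  rewrite AX -/(yb i); congr pair; apply/colP => k; rewrite !mxE ?eqxx //.
  by rewrite inE; case: ifP => // ->.
under eq_bigr do rewrite step /weighted_dist2 /=.
rewrite -mulr_sumr /weighted_dist2 /=; set W := Num.max _ _.
have W0 : 0 <= W by rewrite le_max bigmax_ge_id.
have := @lyapunov_descent R n d A mug muh kappa
  (fun j => (tau j)^-1) (fun j => tau j * theta j) P
  (fun j => x j 0 - xs j 0) (fun j => xb j - xs j 0)
  (fun i => (sigma i)^-1) Q (fun i => y i 0 - ys i 0) (fun i => yb i - ys i 0).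
have k1 := condition_number_ge1 mug muh n0 rowA.
move=> descent.
rewrite [leRHS](_ : _ = W * (n%:R * ((1 - kappa^-1) *
   (\sum_(j < d) P j * (x j 0 - xs j 0) ^+ 2 +
    \sum_(i < n) Q i * (y i 0 - ys i 0) ^+ 2)))); last by rewrite /P /Q; ring.
apply: ler_wpM2l => //.
apply: le_trans (descent _ _ _ _ _ _ _ _ _).
- rewrite le_eqVlt; apply/orP; left; apply/eqP.
  apply: eq_bigr => i _; congr (_ + _); apply: eq_bigr => k _; rewrite !mxE.
    by case: ifP => _; congr (_ * _ ^+ 2); ring.
  by case: ifP => // /eqP ->.
- by lra.
- move=> j; have [fin sub] := Hxs j.
  have := prox_step (x j 0) ((A^T *m y) j 0) (ltW mug0)
    (pcd_tau_gt0 n0 mug0 muh0 rowA colA j) (component_lsc gE pg lg)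
    (component_convex gE pg j cg) (component_neqNy gE pg j)
    (component_strongly_convex_g (j := j)) fin sub.
  rewrite -/(xb j).
  have -> : \sum_(i < n) A i j * (y i 0 - ys i 0) =
      (A^T *m y) j 0 - (A^T *m ys) j 0.
    by rewrite !mxE -sumrB; apply: eq_bigr => i _; rewrite !mxE mulrBr.
  (* The primal displacement term of [prox_step] is discarded; only the dual one enters the
     descent. *)
  have : 0 <= (tau j)^-1 * (xb j - x j 0) ^+ 2.
    by rewrite mulr_ge0 ?sqr_ge0 // invr_ge0 ltW // pcd_tau_gt0.
  lra.
- move=> i; have [fin sub] := Hys i.
  have := prox_step (y i 0) (- Axb i) (ltW muh0)
    (pcd_sigma_gt0 mug0 muh0 rowA i) (component_lsc hE ph lh)
    (component_convex hE ph i ch) (component_neqNy hE ph i)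
    (sh (i := i)) fin sub.
  rewrite mulrN opprK -/(yb i).
  have -> : \sum_(j < d) A i j * (xb j - xs j 0) = Axb i - (A *m xs) i 0.
    by rewrite !mxE -sumrB; apply: eq_bigr => j _; rewrite mulrBr.
  have -> : yb i - ys i 0 - (y i 0 - ys i 0) = yb i - y i 0 by ring.
  lra.
- move=> j; rewrite card_colE /P primal_weightE // divfK // gt_eqF //.
  exact: lt_le_trans ltr01 (card_col_ge1 colA j).
- by move=> j; exact: primal_weight_theta.
- by move=> j; exact: primal_weight_le.
- by move=> i; exact: dual_weightE.
- by move=> i; exact: dual_weight_le.
- by move=> i; exact: tau_theta_le.
Qed.

End Method.

(** * Assembly of the expected complexity bound *)

Theorem theorem4p1 (R : realType) :
  exists2 C : R, 0 < C &
  forall (n d : nat) (A : 'M[R]_(n, d))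
    (g : 'cV[R]_d -> \bar R) (g_ : 'I_d -> R -> \bar R)
    (hs : 'cV[R]_n -> \bar R) (hs_ : 'I_n -> R -> \bar R)
    (mug muh : R) (xs x0 : 'cV[R]_d) (ys y0 : 'cV[R]_n)
    (dT : measure_display) (T : measurableType dT) (P : probability T R)
    (idx : nat -> T -> 'I_n),
  (0 < n)%N ->
  (forall i, row_supp A i != finset.set0) ->
  (forall j, col_supp A j != finset.set0) ->
  proper g -> econvex g -> lower_semicontinuous g ->
  proper hs -> econvex hs -> lower_semicontinuous hs ->
  (forall x, g x = (\sum_(j < d) g_ j (x j 0%R))%E) ->
  (forall y, hs y = (\sum_(i < n) hs_ i (y i 0%R))%E) ->
  0 < mug -> strongly_convex (@dotp R d) mug g ->
  0 < muh -> (forall i, strongly_convex *%R muh (hs_ i)) ->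
  saddle_point A g hs xs ys ->
  (g x0 < +oo)%E -> (hs y0 < +oo)%E ->
  iid_uniform P idx ->
  let z k w :=
    pure_cd A g_ hs_ (fun=> pcd_tau A mug muh) (fun=> pcd_sigma A mug muh)
      (fun=> pcd_theta A mug muh) x0 y0 (fun l => idx l w) k in
  (forall x y, saddle_point A g hs x y -> x = xs /\ y = ys) /\
  (forall eps : R, 0 < eps ->
    exists K : nat,
      expected_complexity A K <=
        C * (((nnz A)%:R +
              (nnz A)%:R * (max_row_norm A / Num.sqrt (muh * mug))) *
             ln (1 + weighted_dist2 A mug muh x0 xs y0 ys / eps)) /\
      forall k, (K <= k)%N ->
        ('E_P[(fun w => (enorm ((z k w).1 - xs) ^+ 2 +
                       enorm ((z k w).2 - ys) ^+ 2)%R)] <= eps%:E)%E).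
Proof.
(* The constant of [iterations_for_accuracy]: the cost factor [nnz A / n] cancels the [n] in
   [condition_number] exactly. *)
exists 3; first by [].
move=> n d A g g_ hs hs_ mug muh xs x0 ys y0 dT T P idx n0 rowA colA
  pg cg lg ph ch lh gE hE mug0 sg muh0 sh sp _ _ iid z.
split=> [x y|eps eps0].
  exact: (saddle_unique mug0 muh0 pg ph gE hE sg sh sp).
have k1 := condition_number_ge1 mug muh n0 rowA.
have distge := weighted_dist2_ge n0 mug0 muh0 rowA colA.
set D := weighted_dist2 A mug muh x0 xs y0 ys.
have D0 : 0 <= D by apply: le_trans (distge _ _ _ _); rewrite addr_ge0 ?sqr_ge0.
have [K [Kle HK]] := iterations_for_accuracy k1 D0 eps0.
exists K; split.
  rewrite /expected_complexity -natr_sum -nnzE.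
  have N0 : 0 <= (nnz A)%:R / n%:R :> R by rewrite divr_ge0.
  have nR : n%:R != 0 :> R by rewrite pnatr_eq0 -lt0n.
  rewrite mulrC [_^-1 * _]mulrC; apply: le_trans (ler_wpM2l N0 Kle) _.
  rewrite /condition_number le_eqVlt; apply/orP; left; apply/eqP.
  by set q := _ / Num.sqrt _; field.
move=> k Kk.
have rho0 : 0 <= 1 - (condition_number A mug muh)^-1.
  by rewrite subr_ge0 invf_le1 //; lra.
apply: le_trans (@expectation_contraction R _ _ P n idx _
  (pure_cd_step A g_ hs_ (pcd_tau A mug muh) (pcd_sigma A mug muh)
     (pcd_theta A mug muh)) n0 iid z (x0, y0) _ _
  (fun s => enorm (s.1 - xs) ^+ 2 + enorm (s.2 - ys) ^+ 2)
  (fun s => weighted_dist2 A mug muh s.1 xs s.2 ys) _ rho0 _ _ k) _ => //.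
- by move=> s; rewrite distge addr_ge0 ?sqr_ge0.
- move=> s.
  exact: (pure_cd_step_contraction n0 mug0 muh0 rowA colA pg cg lg ph ch lh
    gE hE sg sh sp).
- by rewrite lee_fin; exact: HK.
Qed.
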